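(* Consider the tailwind model of linear search in which the robot moves with speed $s \ge 1$ when moving to the right (positive direction) and with speed $1$ when moving to the left. Let $$r = \sqrt{2 + \frac{s+1}{\sqrt{s}}}, \qquad \alpha = \frac{1-s+\sqrt{(s-1)^2+4r^2 s}}{2r},$$ and let $X=\{x_k\}_{k\ge1}=\{s, \alpha r, r^2 s, \alpha r^3, \ldots\}$, i.e. $x_{2k-1}=r^{2k-2}s$ and $x_{2k}=\alpha r^{2k-1}$ for $k\ge 1$. Then $$2 + \frac1s \le \sigma^* \le \sigma_X \le 1+ \frac{s+2\sqrt{s}+1}{s+\sqrt{s}+1} \cdot \frac{s+1}{2s} \cdot \left( s+1 + \sqrt{(s-1)^2 + 8s + 4 \sqrt{s} (s+1)} \right).$$
   Context: A robot starts at the origin of the real line and searches for a stationary target at an unknown point at distance $d$ from the origin (on either side). A zig-zag strategy is an infinite sequence $X=\{x_k\}_{k\ge1}$ of positive reals with $x_k<x_{k+2}$ for all $k$; the zig-zag search with strategy $X$ proceeds in rounds $k=1,2,\dots$: in an odd (resp. even) round the robot moves right (resp. left) from the origin a distance $x_k$, stopping if it reaches the target, and otherwise turns and returns to the origin. The speed of the robot (in both the search and for the omniscient robot) is governed by the model's movement rules. $\sigma_X(d)$ denotes the ratio between the time the robot using $X$ needs to reach a target at distance $d$ (worst case over the target being at $+d$ or $-d$) and the time an omniscient robot, knowing the target's location and obeying the same movement rules, needs to travel from the origin directly to the target. The competitive ratio is $\sigma_X=\sup_{d>1}\sigma_X(d)$, and $\sigma^*$ denotes the optimal (infimum over all strategies)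 competitive ratio. *)

(* Defs.v *)
From HB Require Import structures.
From mathcomp Require Import all_boot all_order all_algebra.
From mathcomp Require Import all_classical all_reals all_analysis.

Set Implicit Arguments.
Unset Strict Implicit.
Unset Printing Implicit Defensive.

Import Order.TTheory GRing.Theory Num.Theory.

Local Open Scope classical_set_scope.
Local Open Scope ring_scope.

(* A strategy x_1, x_2, ... is a function X : nat -> R with X k = x_k for
   k >= 1; the value X 0 is never used. *)
Definition zigzag_strategy (R : realType) (X : nat -> R) : Prop :=
  forall k : nat, (1 <= k)%N -> 0 < X k /\ X k < X k.+2.

(* Movement rule of the tailwind model: speed s to the right, 1 to the left. *)
Definition travel_time (R : realType) (s a b : R) : R :=
  if a <= b then (b - a) / s else a - b.

Definition turning_point (R : realType) (X : nat -> R) (k : nat) : R :=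
  if odd k then X k else - X k.

Definition round_time (R : realType) (s : R) (X : nat -> R) (k : nat) : R :=
  travel_time s 0 (turning_point X k) + travel_time s (turning_point X k) 0.

Definition round_reaches (R : realType) (X : nat -> R) (t : R) (k : nat) : bool :=
  (1 <= k)%N &&
  (if odd k then 0 <= t <= turning_point X k else turning_point X k <= t <= 0).

(* ex_minn picks the first round whose excursion covers t; a target that is
   never reached has search time +oo. *)
Definition search_time (R : realType) (s : R) (X : nat -> R) (t : R) : \bar R :=
  match pselect (exists k : nat, round_reaches X t k) with
  | left reached =>
      ((\sum_(1 <= j < ex_minn reached) round_time s X j) + travel_time s 0 t)%:E
  | right _ => +oo%E
  end.

Definition target_ratio (R : realType) (s : R) (X : nat -> R) (t : R) : \bar R :=
  (search_time s X t * ((travel_time s 0 t)^-1)%:E)%E.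

Definition ratio_at_distance (R : realType) (s : R) (X : nat -> R) (d : R) :
    \bar R :=
  maxe (target_ratio s X d) (target_ratio s X (- d)).

Definition competitive_ratio (R : realType) (s : R) (X : nat -> R) : \bar R :=
  ereal_sup [set ratio_at_distance s X d | d in [set d : R | 1 < d]].

Definition optimal_competitive_ratio (R : realType) (s : R) : \bar R :=
  ereal_inf [set competitive_ratio s X | X in @zigzag_strategy R].

(* Main.v *)
Require Import Defs.
From HB Require Import structures.
From mathcomp Require Import all_boot all_order all_algebra.
From mathcomp Require Import all_classical all_reals all_analysis.
From mathcomp Require Import ring lra.

Set Implicit Arguments.
Unset Strict Implicit.
Unset Printing Implicit Defensive.

Import Order.TTheory GRing.Theory Num.Theory.

Local Open Scope classical_set_scope.
Local Open Scope ring_scope.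

(** For the lower bound, take the first round whose turning point is at a
    distance [x] greater than 1: a target at distance [x] on the other side is
    found only after that round, whose excursion alone costs [(1 + 1/s) x].

    For the upper bound, set [q = r^2] and [b = alpha r], so that the turning
    points alternate between [s q^n] and [b q^n].  On each side the ratio is
    largest just beyond a turning point, where geometric sums bound it by
    [1 + (s + 1) (s + b) q / (s (q - 1))] on the right and by
    [1 + (1 + 1/s) (b + s q) q / (b (q - 1))] on the left.  The number [b] is
    the positive root of [b^2 + (s - 1) b = q s], which makes the two bounds
    equal. *)

(** * Search times and the lower bound for an arbitrary strategy *)

Section Search.
Variables (R : realType) (s : R).
Hypothesis s_gt0 : 0 < s.

Lemma travel_time0r (d : R) : 0 <= d -> travel_time s 0 d = d / s.
Proof. by move=> d0; rewrite /travel_time d0 subr0. Qed.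

Lemma travel_time0l (d : R) : 0 < d -> travel_time s 0 (- d) = d.
Proof. by move=> d0; rewrite /travel_time oppr_ge0 (lt_geF d0) sub0r opprK. Qed.

(** An excursion covers its length once in each direction, so its cost does not depend on the
    side. *)
Lemma round_timeE (X : nat -> R) (k : nat) :
  0 < X k -> round_time s X k = (1 + s^-1) * X k.
Proof.
move=> X0; rewrite /round_time /turning_point; case: (odd k).
  rewrite travel_time0r ?ltW// /travel_time (lt_geF X0) subr0.
  by rewrite mulrDl mul1r addrC mulrC.
rewrite travel_time0l// /travel_time oppr_le0 ltW// sub0r opprK.
by rewrite mulrDl mul1r [_ / s]mulrC.
Qed.

Lemma sum_round_timeE (X : nat -> R) (n : nat) :
  (forall k, (1 <= k)%N -> 0 < X k) ->
  \sum_(1 <= j < n) round_time s X j = (1 + s^-1) * \sum_(1 <= j < n) X j.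
Proof.
move=> X0; rewrite mulr_sumr; apply: eq_big_nat => j /andP[j1 _].
by rewrite round_timeE ?X0.
Qed.

Lemma round_reaches_right (X : nat -> R) (d : R) (k : nat) : 0 < d ->
  round_reaches X d k = [&& (0 < k)%N, odd k & d <= X k].
Proof.
move=> d0; rewrite /round_reaches /turning_point; case: (odd k) => //=.
  by rewrite (ltW d0).
by rewrite (lt_geF d0) !andbF.
Qed.

Lemma round_reaches_left (X : nat -> R) (d : R) (k : nat) : 0 < d ->
  round_reaches X (- d) k = [&& (0 < k)%N, ~~ odd k & d <= X k].
Proof.
move=> d0; rewrite /round_reaches /turning_point; case: (odd k) => /=.
  by rewrite oppr_ge0 (lt_geF d0) andbF.
by rewrite lerN2 oppr_le0 (ltW d0) andbT.
Qed.

(** The last leg takes exactly the omniscient time and accounts for 1 in the ratio; the rounds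
    before the first successful one must fit in the remaining [B - 1]. *)
Lemma target_ratio_le (X : nat -> R) (t B : R) :
  0 < travel_time s 0 t -> (exists k, round_reaches X t k) ->
  (forall k, round_reaches X t k ->
     (forall j, (j < k)%N -> ~~ round_reaches X t j) ->
     \sum_(1 <= j < k) round_time s X j <= (B - 1) * travel_time s 0 t) ->
  (target_ratio s X t <= B%:E)%E.
Proof.
move=> T0 ex H; rewrite /target_ratio /search_time.
case: pselect => // reached; rewrite -EFinM lee_fin ler_pdivrMr//.
case: ex_minnP => k hk kmin.
have := H k hk; rewrite mulrBl mul1r lerBrDr; apply => j jk.
by apply/negP => /kmin; rewrite leqNgt jk.
Qed.

Lemma target_ratio_ge (X : nat -> R) (t A : R) :
  0 < travel_time s 0 t ->
  (forall k, round_reaches X t k ->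
     (A - 1) * travel_time s 0 t <= \sum_(1 <= j < k) round_time s X j) ->
  (A%:E <= target_ratio s X t)%E.
Proof.
move=> T0 H; rewrite /target_ratio /search_time.
case: pselect => [reached|_]; last first.
  by rewrite gt0_mulye ?leey// lte_fin invr_gt0.
rewrite -EFinM lee_fin ler_pdivlMr//.
case: ex_minnP => k hk _.
by have := H k hk; rewrite mulrBl mul1r lerBlDr.
Qed.

Lemma le_ratio_at_distance (X : nat -> R) (t : R) :
  (target_ratio s X t <= ratio_at_distance s X `|t|)%E.
Proof.
rewrite /ratio_at_distance le_max; case: (leP 0 t) => t0.
  by rewrite ger0_norm// lexx.
by rewrite ltr0_norm// opprK lexx orbT.
Qed.

Lemma le_competitive_ratio (X : nat -> R) (t : R) :
  1 < `|t| -> (target_ratio s X t <= competitive_ratio s X)%E.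
Proof.
move=> t1; apply: le_trans (le_ratio_at_distance X t) _.
by apply: ereal_sup_ubound; exists `|t|.
Qed.

(** Round [k] is completed in vain before the target is found, so its cost alone bounds the search
    time; a target never found has ratio [+oo]. *)
Lemma target_ratio_after_round (X : nat -> R) (t A : R) (k : nat) :
  (forall j, (1 <= j)%N -> 0 < X j) -> (1 <= k)%N ->
  (forall j, (j <= k)%N -> ~~ round_reaches X t j) ->
  0 < travel_time s 0 t ->
  (A - 1) * travel_time s 0 t <= (1 + s^-1) * X k ->
  (A%:E <= target_ratio s X t)%E.
Proof.
move=> X0 k1 nreach T0 hA; apply: target_ratio_ge => // n hn.
have kn : (k < n)%N.
  by rewrite ltnNge; apply/negP => nk; move: (nreach n nk); rewrite hn.
apply: le_trans hA _; rewrite sum_round_timeE// ler_wpM2l//.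
  by rewrite addr_ge0 ?ler01// invr_ge0 ltW.
have sum_ge0 m l : (0 < m)%N -> 0 <= \sum_(m <= i < l) X i.
  move=> m0; rewrite big_nat_cond sumr_ge0// => i /andP[/andP[mi _] _].
  by rewrite ltW// X0// (leq_trans m0).
rewrite (@big_cat_nat _ _ _ k.+1)//= big_nat_recr//= -addrA.
by rewrite addrCA lerDl addr_ge0 ?sum_ge0.
Qed.

Lemma competitive_ratio_ge (X : nat -> R) :
  1 <= s -> (forall k, (1 <= k)%N -> 0 < X k) ->
  ((2 + 1 / s)%:E <= competitive_ratio s X)%E.
Proof.
move=> s1 X0.
(* If no turning point lies beyond distance 1, no round reaches the target at 2. *)
have [far|near1] := pselect (exists k, (1 <= k)%N && (1 < X k)); last first.
  apply: le_trans (@le_competitive_ratio X 2 _); last first.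
    by rewrite normr_nat ltr1n.
  apply: target_ratio_ge => [|k].
    by rewrite travel_time0r// divr_gt0.
  rewrite round_reaches_right// => /and3P[k0 _ X2]; case: near1.
  by exists k; rewrite k0 (lt_le_trans _ X2)// ltr1n.
case: (ex_minnP far) => k /andP[k1 Xk1] kmin.
have Xk0 := X0 k k1.
have Xle1 j : (1 <= j)%N -> (j < k)%N -> X j < X k.
  move=> j1 jk; rewrite (le_lt_trans _ Xk1)// leNgt; apply/negP => Xj1.
  by move: (kmin j); rewrite j1 Xj1 => /(_ isT); rewrite leqNgt jk.
(* Earlier rounds are shorter than [X k] by minimality, and round [k] goes to the wrong side. For
   the target at [- X k] the omniscient time is [X k], which gives the bound with equality. *)
have [ko|ke] := boolP (odd k).
  apply: le_trans (@le_competitive_ratio X (- X k) _); last first.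
    by rewrite normrN gtr0_norm.
  apply: (@target_ratio_after_round _ _ _ k) => //.
  - move=> j; rewrite leq_eqVlt => /orP[/eqP->|jk].
      by rewrite round_reaches_left// ko andbF.
    rewrite round_reaches_left//; apply/negP => /and3P[j1 _].
    by rewrite leNgt Xle1.
  - by rewrite travel_time0l.
  - by rewrite travel_time0l// div1r; lra.
(* In the mirrored case the omniscient time is [X k / s], at most [X k] because [1 <= s]. *)
apply: le_trans (@le_competitive_ratio X (X k) _); last by rewrite gtr0_norm.
apply: (@target_ratio_after_round _ _ _ k) => //.
- move=> j; rewrite leq_eqVlt => /orP[/eqP->|jk].
    by rewrite round_reaches_right// (negbTE ke) andbF.
  rewrite round_reaches_right//; apply/negP => /and3P[j1 _].
  by rewrite leNgt Xle1.
- by rewrite travel_time0r ?ltW// divr_gt0.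
- rewrite travel_time0r ?(ltW Xk0)// div1r.
  have -> : 2 + s^-1 - 1 = 1 + s^-1 by ring.
  rewrite ler_wpM2l//; first by rewrite addr_ge0// invr_ge0 ltW.
  by rewrite ler_pdivrMr// ler_peMr// ltW.
Qed.

End Search.

(** * Strategies whose turning points are geometric on each side *)

Section Geometric.
Variables (R : realType) (a b q : R) (X : nat -> R).
Hypotheses (a_gt0 : 0 < a) (b_gt0 : 0 < b) (q_gt1 : 1 < q).
Hypothesis X_odd : forall n, X n.*2.+1 = a * q ^+ n.
Hypothesis X_even : forall n, X n.*2.+2 = b * q ^+ n.

Let q_gt0 : 0 < q. Proof. exact: lt_trans q_gt1. Qed.

Lemma geometric_zigzag : zigzag_strategy X.
Proof.
move=> [//|k] _; rewrite -[k]odd_double_half.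
have qq n : q ^+ n < q ^+ n.+1 by rewrite ltr_eXn2l.
case: (odd k); rewrite ?add1n ?add0n; split.
- by rewrite X_even mulr_gt0 ?exprn_gt0.
- by rewrite X_even -doubleS X_even ltr_pM2l.
- by rewrite X_odd mulr_gt0 ?exprn_gt0.
- by rewrite X_odd -doubleS X_odd ltr_pM2l.
Qed.

Lemma geometric_sum_odd n :
  (q - 1) * \sum_(1 <= j < n.*2.+1) X j = (a + b) * (q ^+ n - 1).
Proof.
elim: n => [|n IH]; first by rewrite big_nil expr0 subrr !mulr0.
rewrite doubleS 2?big_nat_recr//= X_odd X_even 2!mulrDr IH exprS.
by ring.
Qed.

Lemma geometric_sum_even n :
  (q - 1) * \sum_(1 <= j < n.*2.+2) X j = (b + a * q) * q ^+ n - (a + b).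
Proof.
by rewrite big_nat_recr//= mulrDr geometric_sum_odd X_odd; ring.
Qed.

(** Follows from the Bernoulli-type bound [n (q - 1) <= q ^+ n] and the Archimedean property; it
    ensures that every target is reached. *)
Lemma geometric_unbounded (c d : R) : 0 < c -> exists n, d <= c * q ^+ n.
Proof.
move=> c0.
have bern n : n%:R * (q - 1) <= q ^+ n.
  elim: n => [|n IH]; first by rewrite mul0r expr0.
  rewrite -natr1 exprS mulrDl mul1r.
  have qn : 1 <= q ^+ n by rewrite exprn_ege1// ltW.
  have : (q - 1) * 1 <= (q - 1) * q ^+ n by rewrite ler_wpM2l// subr_ge0 ltW.
  by move: IH; lra.
have [n hn] : exists n : nat, `|d| / c / (q - 1) < n%:R.
  exists (Num.bound (`|d| / c / (q - 1))).
  by rewrite archi_boundP// !divr_ge0// ?ltW// subr_gt0.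
exists n; rewrite (le_trans (ler_norm d))// mulrC -ler_pdivrMr//.
by rewrite (le_trans _ (bern n))// -ler_pdivrMr ?subr_gt0// ltW.
Qed.

(** The three conditions cover targets missed by an earlier right round, targets missed by an
    earlier left round, and targets found in the first left round, which only the round of length
    [a] precedes. *)
Lemma geometric_ratio_le (s B : R) : 0 < s ->
  (s + 1) * (a + b) * q <= (B - 1) * a * (q - 1) ->
  (1 + s^-1) * (b + a * q) * q <= (B - 1) * b * (q - 1) ->
  (1 + s^-1) * a <= B - 1 ->
  (competitive_ratio s X <= B%:E)%E.
Proof.
move=> s0 hright hleft hfirst.
have p0 : 0 < q - 1 by rewrite subr_gt0.
have si0 : 0 < s^-1 by rewrite invr_gt0.
have B0 : 0 <= B - 1.
  by apply: le_trans hfirst; rewrite mulr_ge0 ?ltW// addr_gt0.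
have X0 k : (1 <= k)%N -> 0 < X k by move=> /geometric_zigzag[].
apply: ge_ereal_sup => _ [d d1 <-].
have d0 : 0 < d by apply: lt_trans d1.
rewrite /ratio_at_distance ge_max; apply/andP; split.
  apply: target_ratio_le.
  - by rewrite travel_time0r ?ltW// divr_gt0.
  - have [n hn] := geometric_unbounded d a_gt0.
    by exists n.*2.+1; rewrite round_reaches_right//= odd_double X_odd.
  move=> k; rewrite round_reaches_right// => /and3P[k0 ko _] kmin.
  rewrite travel_time0r ?(ltW d0)// sum_round_timeE//.
  move: (odd_double_half k) kmin; rewrite ko add1n => <-.
  (* A target found in round 1 has no earlier rounds. Otherwise the previous right round [n.*2.+1]
     failed, so [a * q ^+ n < d]. *)
  case: (k./2) => [_|n /(_ n.*2.+1)].
    by rewrite big_nil mulr0 mulr_ge0// divr_ge0// ltW.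
  rewrite doubleS ltnS leqnSn round_reaches_right//= odd_double /= -ltNge X_odd.
  move=> /(_ isT) hd; rewrite -doubleS.
  rewrite -(ler_pM2l p0) mulrCA geometric_sum_odd.
  have -> : (1 + s^-1) = (s + 1) / s by field; rewrite gt_eqF.
  rewrite -(ler_pM2r s0).
  have -> : (q - 1) * ((B - 1) * (d / s)) * s = (q - 1) * (B - 1) * d.
    by field; rewrite gt_eqF.
  have -> : (s + 1) / s * ((a + b) * (q ^+ n.+1 - 1)) * s
     = (s + 1) * (a + b) * q * q ^+ n - (s + 1) * (a + b).
    by rewrite exprS; field; rewrite gt_eqF.
  have h1 := ler_wpM2r (exprn_ge0 n (ltW q_gt0)) hright.
  have h2 : (q - 1) * (B - 1) * (a * q ^+ n) <= (q - 1) * (B - 1) * d.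
    by rewrite ler_wpM2l ?(ltW hd)// mulr_ge0// ltW.
  (* The constant subtracted in the geometric sum only helps and is dropped. *)
  have h3 : 0 <= (s + 1) * (a + b) by rewrite mulr_ge0 ?ltW ?addr_gt0.
  by move: h1 h2 h3; lra.
apply: target_ratio_le.
- by rewrite travel_time0l.
- have [n hn] := geometric_unbounded d b_gt0.
  by exists n.*2.+2; rewrite round_reaches_left//= odd_double X_even.
move=> k; rewrite round_reaches_left// => /and3P[k0 ke _] kmin.
rewrite travel_time0l// sum_round_timeE//.
move: (odd_double_half k) k0 kmin; rewrite (negbTE ke) add0n => <-.
(* In round 2 there is no failed left round to bound [d] from below, so [1 < d] is used; later, the
   previous left round gives [b * q ^+ n < d]. *)
case: (k./2) => [//|[_ _|n _ /(_ n.*2.+2)]].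
  rewrite big_nat1 (X_odd 0) expr0 mulr1 (le_trans hfirst)//.
  by rewrite ler_peMr// ltW.
rewrite !doubleS !ltnS leqnSn round_reaches_left//= odd_double /= -ltNge X_even.
move=> /(_ isT) hd; rewrite -!doubleS [n.+2.*2]doubleS.
rewrite -(ler_pM2l p0) mulrCA geometric_sum_even exprS.
have h1 := ler_wpM2r (exprn_ge0 n (ltW q_gt0)) hleft.
have h2 : (q - 1) * (B - 1) * (b * q ^+ n) <= (q - 1) * (B - 1) * d.
  by rewrite ler_wpM2l ?(ltW hd)// mulr_ge0// ltW.
have h3 : 0 <= (1 + s^-1) * (a + b) by rewrite mulr_ge0 ?ltW ?addr_gt0.
by move: h1 h2 h3; lra.
Qed.

End Geometric.

(** * The tailwind strategy and the closed form of its bound *)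

Theorem theorem1 (R : realType) (s r alpha : R) (X : nat -> R)
    (hs : 1 <= s)
    (hr : r = Num.sqrt (2 + (s + 1) / Num.sqrt s))
    (halpha : alpha =
       (1 - s + Num.sqrt ((s - 1) ^+ 2 + 4 * r ^+ 2 * s)) / (2 * r))
    (hX : forall k : nat, (1 <= k)%N ->
       X (2 * k - 1)%N = r ^+ (2 * k - 2)%N * s /\
       X (2 * k)%N = alpha * r ^+ (2 * k - 1)%N) :
  ((2 + 1 / s)%:E <= optimal_competitive_ratio s)%E /\
  (optimal_competitive_ratio s <= competitive_ratio s X)%E /\
  (competitive_ratio s X <=
     (1 + (s + 2 * Num.sqrt s + 1) / (s + Num.sqrt s + 1)
          * ((s + 1) / (2 * s))
          * (s + 1 + Num.sqrt ((s - 1) ^+ 2 + 8 * s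
                               + 4 * Num.sqrt s * (s + 1))))%:E)%E.
Proof.
have s0 : 0 < s by apply: lt_le_trans hs.
set u := Num.sqrt s in hr *.
have u0 : 0 < u by rewrite sqrtr_gt0.
have uu : u * u = s by rewrite -expr2 sqr_sqrtr// ltW.
have q_ge2 : 0 < (s + 1) / u by rewrite divr_gt0// addr_gt0.
have r0 : 0 < r by rewrite hr sqrtr_gt0 addr_gt0.
set q := r ^+ 2 in halpha *.
have qE : q = 2 + (s + 1) / u by rewrite /q hr sqr_sqrtr// addr_ge0// ltW.
have q1 : 1 < q by rewrite qE; lra.
have q0 : 0 < q := lt_trans ltr01 q1.
(* This identifies the radicand in the stated bound with the one in [alpha]. *)
have q4s : 4 * q * s = 8 * s + 4 * u * (s + 1).
  by rewrite qE -uu; field; rewrite gt_eqF.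
set D := Num.sqrt _ in halpha.
have -> : Num.sqrt ((s - 1) ^+ 2 + 8 * s + 4 * u * (s + 1)) = D.
  by rewrite /D q4s addrA.
have DD : D ^+ 2 = (s - 1) ^+ 2 + 4 * q * s.
  by rewrite sqr_sqrtr// addr_ge0 ?sqr_ge0// !mulr_ge0// ltW.
have D0 : 0 <= D by apply: sqrtr_ge0.
set b := alpha * r.
have bE : b = (1 - s + D) / 2 by rewrite /b halpha; field; rewrite gt_eqF.
have b0 : 0 < b.
  rewrite bE divr_gt0//; suff : s - 1 < D by lra.
  by rewrite -ltr_sqr ?nnegrE ?subr_ge0// DD ltrDl !mulr_gt0.
have bq : b ^+ 2 + (s - 1) * b = q * s by rewrite bE; move: DD; lra.
have X_odd n : X n.*2.+1 = s * q ^+ n.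
  have [+ _] := hX n.+1 isT.
  by rewrite mulnS addKn mul2n add2n subn1 => ->; rewrite -mul2n exprM mulrC.
have X_even n : X n.*2.+2 = b * q ^+ n.
  have [_] := hX n.+1 isT; rewrite mulnS mul2n add2n subn1 => ->.
  by rewrite exprS -mul2n exprM mulrA.
have hz := geometric_zigzag s0 b0 q1 X_odd X_even.
split; [|split].
- apply: le_ereal_inf_tmp => _ [Y hY <-].
  by apply: competitive_ratio_ge => // k /hY[].
- by apply: ereal_inf_lbound; exists X.
set B := _ + _ * _ * _.
(* The first fraction in [B] is [q / (q - 1)], and [s + 1 + D = 2 * (s + b)]; hence the condition on
   the right holds with equality. *)
have BE : (B - 1) * (q - 1) * s = (s + 1) * q * (s + b).
  rewrite /B qE bE; field.
  by rewrite !gt_eqF ?addr_gt0.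
have pB : (1 + s^-1) * s = s + 1 by field; rewrite gt_eqF.
have p0 : 0 < q - 1 by rewrite subr_gt0.
apply: (geometric_ratio_le s0 b0 q1 X_odd X_even s0).
- by move: BE; lra.
(* By [bq], [(s + b) * b = b + q * s], so the condition on the left is an equality too. *)
- rewrite -(ler_pM2r s0).
  have -> : (1 + s^-1) * (b + s * q) * q * s = (s + 1) * q * (b + q * s).
    by rewrite -pB; ring.
  have -> : (B - 1) * b * (q - 1) * s = (B - 1) * (q - 1) * s * b by ring.
  have -> : (B - 1) * (q - 1) * s * b = (s + 1) * q * (b + q * s).
    by rewrite BE -bq; ring.
  exact: lexx.
(* After scaling by [(q - 1) * s], the first-round condition reduces to [q - 1 <= q] and
   [s <= s + b]. *)
rewrite pB -(ler_pM2r (mulr_gt0 p0 s0)) [leRHS]mulrA BE -mulrA.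
rewrite ler_wpM2l//; first by rewrite addr_ge0// ltW.
by apply: ler_pM; rewrite ?lerDl ?gerBl ?ler01 ?(ltW p0) ?(ltW s0) ?(ltW b0).
Qed.
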